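(* The $L^1$ Dirac-Sobolev inequality fails: there is no constant $C>0$ such that $$\left( \int_{\mathbb{R}^3} |f(\mathbf{x})|_{3/2}^{3/2}\, d\mathbf{x} \right)^{2/3} \le C \int_{\mathbb{R}^3} |(\boldsymbol{\sigma}\cdot\mathbf{p}) f(\mathbf{x})|_1\, d\mathbf{x}$$ for all $f\in C_0^\infty(\mathbb{R}^3,\mathbb{C}^2)$.
   Context: $C_0^\infty(\mathbb{R}^3,\mathbb{C}^2)$ is the space of $\mathbb{C}^2$-valued functions on $\mathbb{R}^3$ whose components are smooth with compact support. The Pauli matrices are $\sigma_1=\begin{pmatrix}0&1\\1&0\end{pmatrix}$, $\sigma_2=\begin{pmatrix}0&-i\\i&0\end{pmatrix}$, $\sigma_3=\begin{pmatrix}1&0\\0&-1\end{pmatrix}$, and $\boldsymbol{\sigma}\cdot\mathbf{p} = -i\sum_{j=1}^3 \sigma_j \frac{\partial}{\partial x_j}$. For $\mathbf{a}=(a_1,a_2)\in\mathbb{C}^2$ and $p\ge 1$, $|\mathbf{a}|_p^p = |a_1|^p+|a_2|^p$. *)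

(* Defs.v *)
From HB Require Import structures.
From mathcomp Require Import all_boot all_order all_algebra.
From mathcomp Require Import all_classical all_reals all_analysis.
From mathcomp Require Export complex.

Set Implicit Arguments.
Unset Strict Implicit.
Unset Printing Implicit Defensive.
Import Order.TTheory GRing.Theory Num.Theory.
Import numFieldNormedType.Exports.

Local Open Scope classical_set_scope.
Local Open Scope ring_scope.
Local Open Scope complex_scope.

(* Notations rather than definitions, so that the normed-module and
   measure structures of products are found by inference. *)
Notation space3 R := ((R * R * R)%type) (only parsing).
Notation spinor R := ('cV[R[i]]_2) (only parsing).

Notation lebesgue3 R :=
  ((@lebesgue_measure R \x @lebesgue_measure R) \x @lebesgue_measure R)%E
  (only parsing).

Section Space.
Context {R : realType}.

Definition basis3 (j : 'I_3) : space3 R :=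
  tnth [tuple (1, 0, 0); (0, 1, 0); (0, 0, 1)] j.

(* The index sequence [:: j1; ...; jm] stands for the iterated partial derivative
   d/dx_j1 ... d/dx_jm. *)
Definition partials (s : seq 'I_3) (g : space3 R -> R) : space3 R -> R :=
  foldr (fun j h => 'D_(basis3 j) h) g s.

(* The total operator 'D_v is unspecified where the limit does not exist, hence
   the explicit derivability clause. *)
Definition smooth (g : space3 R -> R) : Prop :=
  forall s : seq 'I_3,
    continuous (partials s g) /\
    forall (j : 'I_3) (x : space3 R), derivable (partials s g) x (basis3 j).

Definition csmooth (u : space3 R -> R[i]) : Prop :=
  smooth (fun x => complex.Re (u x)) /\ smooth (fun x => complex.Im (u x)).

Definition compact_support (u : space3 R -> R[i]) : Prop :=
  compact (closure [set x | u x != 0]).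

Definition C0_infty (f : space3 R -> spinor R) : Prop :=
  forall k : 'I_2,
    csmooth (fun x => f x k ord0) /\ compact_support (fun x => f x k ord0).

(* The components are differentiated as functions of real variables, separately
   in their real and imaginary parts. *)
Definition partial (j : 'I_3) (f : space3 R -> spinor R) (x : space3 R) :
    spinor R :=
  \col_k ('D_(basis3 j) (fun y => complex.Re (f y k ord0)) x
          +i* 'D_(basis3 j) (fun y => complex.Im (f y k ord0)) x).

Definition mx2 (a b c d : R[i]) : 'M[R[i]]_2 :=
  \matrix_(k, l) (if k == ord0 then if l == ord0 then a else b
                  else if l == ord0 then c else d).

(* Without %C, 'i could be read as the imaginary unit of numClosedFieldType. *)
Definition pauli (j : 'I_3) : 'M[R[i]]_2 :=
  tnth [tuple mx2 0 1
                  1 0;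
              mx2 0 (- 'i%C)
                  'i%C 0;
              mx2 1 0
                  0 (-1)] j.

Definition sigma_p (f : space3 R -> spinor R) (x : space3 R) : spinor R :=
  (- 'i%C) *: \sum_(j < 3) pauli j *m partial j f x.

(* The norm of R[i] takes values in R[i]; complex.Re brings the modulus back
   to R. *)
Definition pnorm (p : R) (a : spinor R) : R :=
  (\sum_(k < 2) complex.Re `|a k ord0| `^ p) `^ p^-1.

End Space.

(* Main.v *)
(** The field [f = psi(|x|^2) (sigma . x) e_1] satisfies
    [(sigma . p) f = -i (3 psi + 2 s psi') e_1] with [s = |x|^2], which vanishes
    for [psi = s^(-3/2)], that is for the fundamental solution
    [(sigma . x) / |x|^3]; this field just fails to be in [L^(3/2)] at 0.
    We regularize it at scale [eta] by [psi = (s^2 + eta^4)^(-3/4)], times a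
    smooth cutoff.  Then [|(sigma . p) f|] is at most a constant times the sum
    of two products of one-dimensional Poisson kernels, of widths [1] and [eta],
    whose integrals do not depend on [eta]; while for [eta = 2^-N] each of the
    dyadic cubes [(2^(-k-2), 2^(-k-1)]^3], [k < N], contributes at least a fixed
    positive amount to the integral of [|f|^(3/2)].  Letting [N] go to infinity
    refutes any constant. *)
From HB Require Import structures.
Require Import Defs.
From mathcomp Require Import all_boot all_order all_algebra.
From mathcomp Require Import all_classical all_reals all_analysis.
From mathcomp Require Import measurable_realfun ring lra.

Set Implicit Arguments.
Unset Strict Implicit.
Unset Printing Implicit Defensive.
Import Order.TTheory GRing.Theory Num.Theory.
Import numFieldNormedType.Exports.
Local Open Scope classical_set_scope.
Local Open Scope ring_scope.

(** * One-variable building blocks: the flat function and the power -1/4 *)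

Section OneVariable.
Context {R : realType}.
Implicit Types t x : R.

(* The factor [t ^- n] makes the family closed under differentiation. *)
Definition flat (n : nat) t : R := if 0 < t then t ^- n * expR (- t^-1) else 0.

(** The exponent -1/4 makes the derivative a constant times the fifth power of the function itself,
    so that polynomials in it are closed under differentiation; its cube gives the exponent -3/4 of
    the regularized kernel. *)
Definition invroot4 t : R := t `^ (- 4^-1).

Lemma flat_ge0 n t : 0 <= flat n t.
Proof.
rewrite /flat; case: ifPn => // t0.
by rewrite mulr_ge0 ?expR_ge0// invr_ge0 exprn_ge0// ltW.
Qed.

Lemma flat_eq0 n t : t <= 0 -> flat n t = 0.
Proof. by rewrite /flat ltNge => ->. Qed.

(** With [u = 1/t], one term of the exponential series gives [u^m <= m! e^u] for [m = n + k + 1]. So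
    [flat n] vanishes to every order at 0. *)
Lemma flat_le n k t : flat n t <= (n + k).+1`!%:R * `|t| ^+ k.+1.
Proof.
rewrite /flat; case: ifPn => t0; last by rewrite mulr_ge0.
rewrite gtr0_norm// expRN ler_pdivrMr ?expR_gt0//.
have it0 : 0 <= t^-1 by rewrite invr_ge0 ltW.
have H : t^-1 ^+ (n + k).+1 <= (n + k).+1`!%:R * expR t^-1.
  rewrite -ler_pdivrMl ?ltr0n ?fact_gt0// [leLHS]mulrC.
  by apply: le_trans (expR_ge1Dxn (n + k) it0); rewrite lerDr.
have -> : t ^- n = t^-1 ^+ (n + k).+1 * t ^+ k.+1.
  rewrite -addnS exprD -mulrA -exprMn mulVf ?lt0r_neq0// expr1n mulr1.
  by rewrite exprVn.
by rewrite mulrAC ler_wpM2r// exprn_ge0// ltW.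
Qed.

Lemma flat0_le1 t : flat 0 t <= 1.
Proof.
rewrite /flat; case: ifPn => // t0.
by rewrite expr0 invr1 mul1r -expR0 ler_expR oppr_le0 invr_ge0 ltW.
Qed.

(** With [u = 1/t] this is [u^2 <= 2 e^u], from the quadratic term of the exponential series. *)
Lemma flat2_le2 t : flat 2 t <= 2.
Proof.
rewrite /flat; case: ifPn => t0; last by lra.
rewrite expRN ler_pdivrMr ?expR_gt0//.
have it0 : 0 <= t^-1 by rewrite invr_ge0 ltW.
have := expR_ge1Dxn 1 it0; rewrite exprVn (_ : 2`! = 2)%N//.
lra.
Qed.

Lemma is_derive_flat n t :
  is_derive t 1 (flat n) (flat n.+2 t - n%:R * flat n.+1 t).
Proof.
have [t0|t0|->] := ltgtP t 0.
- rewrite /flat (lt_gtF t0) mulr0 subrr.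
  apply: (@near_eq_is_derive _ _ _ (cst 0)).
  near=> y; rewrite lt_gtF//.
  by near: y; exact: lt_nbhsl.
(* For [t > 0] both factors are merged into the single exponential of [- 1/t - n ln t], so that one
   use of the chain rule suffices. *)
- refine (@near_eq_is_derive R R R
    (fun y => expR (- (y^-1) + - n%:R * ln y)) (flat n) t 1 _ _ _).
    near=> y; have y0 : 0 < y by near: y; exact: lt_nbhsr.
    rewrite /flat y0 expRD mulrC; congr (_ * _).
    by rewrite mulNr expRN expRM_natl lnK.
  have dV : is_derive t 1 (fun y : R => y^-1) (- t ^- 2 *: 1).
    by apply: is_deriveV; rewrite ?lt0r_neq0.
  have dL := is_derive1_ln t0.
  have H : is_derive t 1 (fun y => - (y^-1) + - n%:R * ln y)
     (t ^- 2 - n%:R * t^-1).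
    apply: (@is_derive_eq _ _ _ _ _ _ _ (- (- t ^- 2 *: 1) + - n%:R *: t^-1)).
    by rewrite scaleNr opprK scaleNr /GRing.scale/= mulr1.
  have := is_derive1_comp (is_derive_expR _) H.
  rewrite /flat t0; set e := expR (_ + _) => K.
  apply: is_derive_eq K _.
  have -> : e = expR (- t^-1) * t ^- n.
    by rewrite /e expRD mulNr (expRN (n%:R * _)) expRM_natl lnK.
  rewrite !exprS !invfM expr0 invr1; ring.
rewrite /flat ltxx mulr0 subrr.
(* At 0 the difference quotient is at most [(n + 2)! |h|], by [flat_le] with [k = 1]. *)
have H : (fun h : R => h^-1 *: ((flat n \o shift 0) (h *: 1) - flat n 0))
    @ 0^' --> (0 : R).
  apply/cvgrPdist_le => e e0; near=> h.
  have h0 : h != 0 by near: h; exact: nbhs_dnbhs_neq.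
  rewrite /= sub0r normrN addr0 [h%:A]mulr1 [flat n 0]/flat ltxx subr0.
  rewrite normrM normfV.
  rewrite ler_pdivrMl ?normr_gt0// (ger0_norm (flat_ge0 _ _)).
  apply: le_trans (flat_le n 1 h) _.
  rewrite expr2 mulrCA ler_wpM2l//.
  rewrite -ler_pdivlMl ?ltr0n ?fact_gt0//.
  near: h; apply: dnbhs0_le; by rewrite mulr_gt0 ?invr_gt0 ?ltr0n ?fact_gt0.
apply: DeriveDef; first by apply/cvg_ex; exists 0.
exact: cvg_lim H.
Unshelve. all: by end_near. Qed.

Lemma invroot4_gt0 t : 0 < t -> 0 < invroot4 t.
Proof. exact: powR_gt0. Qed.

Lemma invroot4X4 t : 0 < t -> invroot4 t ^+ 4 = t^-1.
Proof.
move=> t0; rewrite -powR_mulrn ?powR_ge0// -powRrM mulNr mulVf ?pnatr_eq0//.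
by rewrite powR_inv1// ltW.
Qed.

Lemma is_derive_invroot4 t : 0 < t ->
  is_derive t 1 invroot4 (- 4^-1 * invroot4 t ^+ 5).
Proof.
move=> t0; apply: is_derive_eq (is_derive1_powR (- 4^-1) t0) _.
congr (_ * _); rewrite exprS invroot4X4// powRD ?lt0r_neq0 ?implybT//.
by rewrite powR_inv1 ?ltW.
Qed.

Lemma continuous_flat n : continuous (flat n).
Proof.
move=> t; apply/differentiable_continuous/derivable1_diffP.
exact: (@ex_derive _ _ _ _ _ _ _ (is_derive_flat n t)).
Qed.

Lemma continuous_invroot4 t : 0 < t -> {for t, continuous invroot4}.
Proof.
move=> t0; apply/differentiable_continuous/derivable1_diffP.
exact: (@ex_derive _ _ _ _ _ _ _ (is_derive_invroot4 t0)).
Qed.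

End OneVariable.

(** * A class of smooth functions on space, stable under differentiation *)

Section Elementary.
Context {R : realType}.
Implicit Types (u w : space3 R -> R) (x v : space3 R).

(** Restricting to the line through [x] in direction [v] turns a directional derivative into an
    ordinary one, to which the one-variable chain rule applies. *)
Lemma is_derive_alongE u x v du :
  is_derive x v u du <->
  is_derive (0 : R) (1 : R) (fun h : R => u (h *: v + x)) du.
Proof.
have E : 'D_v u x = 'D_(1 : R) (fun h : R => u (h *: v + x)) (0 : R).
  rewrite /derive; set g1 := fun h => h^-1 *: _; set g2 := fun h => h^-1 *: _.
  suff -> : g1 = g2 by [].
  by rewrite funeqE /g1 /g2 => h /=; rewrite addr0 scale0r add0r [_%:A]mulr1.
split=> -[d <-].
  exact: DeriveDef (proj1 (derivable1P _ _ _) d) (esym E).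
exact: DeriveDef (proj2 (derivable1P _ _ _) d) E.
Qed.

Lemma is_derive_comp_along (phi : R -> R) u x v a b :
  is_derive (u x) 1 phi a -> is_derive x v u b ->
  is_derive x v (fun y => phi (u y)) (a * b).
Proof.
move=> dphi /is_derive_alongE du; apply/is_derive_alongE.
by apply: (is_derive1_comp (f := phi)) => //; rewrite scale0r add0r.
Qed.

Lemma is_derive_affine u x v a :
  (forall h : R, u (h *: v + x) = h * a + u x) -> is_derive x v u a.
Proof.
move=> ua; apply/is_derive_alongE.
rewrite (_ : (fun _ => _) = (fun h => h * a + u x)); last exact/funext.
by apply: is_derive_eq; rewrite scaler0 add0r addr0 /GRing.scale/= mulr1.
Qed.

(* A class of functions closed under partial derivatives: this is what makes
   smoothness, defined by iterated derivatives, provable by induction. *)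
Inductive elementary : (space3 R -> R) -> Prop :=
| elementary_cst c : elementary (fun=> c)
| elementary_x : elementary (fun x => x.1.1)
| elementary_y : elementary (fun x => x.1.2)
| elementary_z : elementary (fun x => x.2)
| elementary_add u w :
    elementary u -> elementary w -> elementary (fun x => u x + w x)
| elementary_mul u w :
    elementary u -> elementary w -> elementary (fun x => u x * w x)
| elementary_flat n u : elementary u -> elementary (fun x => flat n (u x))
| elementary_invroot4 u : (forall x, 0 < u x) ->
    elementary u -> elementary (fun x => invroot4 (u x)).

Lemma elementary_exprn u n : elementary u -> elementary (fun x => u x ^+ n).
Proof.
move=> eu; elim: n => [|n IHn]; first exact: elementary_cst.
rewrite (_ : (fun _ => _) = (fun x => u x * u x ^+ n)).
  exact: elementary_mul.
by apply/funext => x; rewrite exprS.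
Qed.

Lemma elementary_derive u v : elementary u ->
  exists2 du, elementary du & forall x, is_derive x v u (du x).
Proof.
elim=> {u} [c||||u w _ [du eu du_u] _ [dw ew dw_w]|
  u w eu [du edu du_u] ew [dw edw dw_w]|n u eu [du edu du_u]|
  u u0 eu [du edu du_u]].
- exists (fun=> 0); first exact: elementary_cst.
  by move=> x; exact: is_derive_cst.
- exists (fun=> v.1.1); first exact: elementary_cst.
  by move=> x; exact: is_derive_affine.
- exists (fun=> v.1.2); first exact: elementary_cst.
  by move=> x; exact: is_derive_affine.
- exists (fun=> v.2); first exact: elementary_cst.
  by move=> x; exact: is_derive_affine.
- exists (fun x => du x + dw x); first exact: elementary_add.
  by move=> x; exact: is_deriveD.
- exists (fun x => u x * dw x + w x * du x).
    by apply: elementary_add; exact: elementary_mul.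
  by move=> x; exact: is_deriveM.
- exists (fun x => (flat n.+2 (u x) + - n%:R * flat n.+1 (u x)) * du x).
    apply: elementary_mul => //; apply: elementary_add.
      exact: elementary_flat.
    apply: elementary_mul; first exact: elementary_cst.
    exact: elementary_flat.
  move=> x; rewrite mulNr; apply: is_derive_comp_along => //.
  exact: is_derive_flat.
- exists (fun x => - 4^-1 * (invroot4 (u x) * (invroot4 (u x) *
    (invroot4 (u x) * (invroot4 (u x) * invroot4 (u x))))) * du x).
    apply: elementary_mul => //; apply: elementary_mul.
      exact: elementary_cst.
    have e := elementary_invroot4 u0 eu.
    by do 4 apply: elementary_mul => //.
  move=> x; apply: is_derive_comp_along => //.
  by apply: is_derive_eq (is_derive_invroot4 (u0 x)) _; rewrite !exprS mulr1.
Qed.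

Lemma elementary_continuous u : elementary u -> continuous u.
Proof.
elim=> {u} [c||||u w _ cu _ cw|u w _ cu _ cw|n u _ cu|u u0 _ cu] x.
- exact: cvg_cst.
- by apply: (@continuous_comp _ _ _ fst fst); exact: cvg_fst.
- by apply: (@continuous_comp _ _ _ fst snd); [exact: cvg_fst|exact: cvg_snd].
- exact: cvg_snd.
- by apply: cvgD; [exact: cu|exact: cw].
- by apply: cvgM; [exact: cu|exact: cw].
- by apply: (@continuous_comp _ _ _ u (flat n));
    [exact: cu|exact: continuous_flat].
- by apply: (@continuous_comp _ _ _ u invroot4);
    [exact: cu|exact: continuous_invroot4].
Qed.

Lemma elementary_smooth u : elementary u -> smooth u.
Proof.
move=> eu s.
have es : elementary (partials s u).
  elim: s => [//|j s /(elementary_derive (basis3 j))[du edu du_u]] /=.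
  rewrite (_ : 'D_(basis3 j) _ = du)//; apply/funext => x.
  exact: (@derive_val _ _ _ _ _ _ _ (du_u x)).
split; first exact: elementary_continuous.
move=> j x; have [du _ du_u] := elementary_derive (basis3 j) es.
exact: (@ex_derive _ _ _ _ _ _ _ (du_u x)).
Qed.

Lemma elementary_measurable u : elementary u -> measurable_fun setT u.
Proof.
elim=> {u} [c||||u w _ mu _ mw|u w _ mu _ mw|n u _ mu|u u0 _ mu].
- exact: measurable_cst.
- exact: measurableT_comp measurable_fst measurable_fst.
- exact: measurableT_comp measurable_snd measurable_fst.
- exact: measurable_snd.
- exact: measurable_funD.
- exact: measurable_funM.
- apply: measurableT_comp mu; apply: continuous_measurable_fun.
  exact: continuous_flat.
- by apply: measurableT_comp mu; exact: measurable_powR.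
Qed.

End Elementary.

(** * The Dirac operator on radial multiples of [(sigma . x) e_1] *)

Section Hedgehog.
Context {R : realType}.
Implicit Types (x v : space3 R) (psi : R -> R).

Definition normsq3 x : R := x.1.1 * x.1.1 + x.1.2 * x.1.2 + x.2 * x.2.

(** The first column of the matrix [sigma . x] is [(z, x + iy)]. *)
Definition hedgehog psi x : spinor R :=
  \col_k (if k == ord0 then psi (normsq3 x) * x.2 +i* 0
          else psi (normsq3 x) * x.1.1 +i* (psi (normsq3 x) * x.1.2))%C.

Lemma elementary_normsq3 : elementary normsq3.
Proof.
have ex : elementary (fun x => x.1.1) := elementary_x.
have ey : elementary (fun x => x.1.2) := elementary_y.
have ez : elementary (fun x => x.2) := elementary_z.
by do !apply: elementary_add; exact: elementary_mul.
Qed.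

Lemma is_derive_normsq3 x v :
  is_derive x v normsq3 (2 * (x.1.1 * v.1.1 + x.1.2 * v.1.2 + x.2 * v.2)).
Proof.
have dx : is_derive x v (fun y => y.1.1) v.1.1 by exact: is_derive_affine.
have dy : is_derive x v (fun y => y.1.2) v.1.2 by exact: is_derive_affine.
have dz : is_derive x v (fun y => y.2) v.2 by exact: is_derive_affine.
apply: is_derive_eq (is_deriveD (is_deriveD (is_deriveM dx dx)
  (is_deriveM dy dy)) (is_deriveM dz dz)) _.
by rewrite /GRing.scale/=; ring.
Qed.

Lemma is_derive_radial_mul psi dpsi (p : space3 R -> R) x v dp :
  is_derive (normsq3 x) 1 psi dpsi -> is_derive x v p dp ->
  is_derive x v (fun y => psi (normsq3 y) * p y)
    (psi (normsq3 x) * dp +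
     dpsi * (2 * (x.1.1 * v.1.1 + x.1.2 * v.1.2 + x.2 * v.2)) * p x).
Proof.
move=> dpsi_s dp_x.
apply: is_derive_eq (is_deriveM (is_derive_comp_along dpsi_s
  (is_derive_normsq3 x v)) dp_x) _.
by rewrite /GRing.scale/=; ring.
Qed.

Lemma mx2_mul (a b c d : R[i]) (q : spinor R) :
  mx2 a b c d *m q =
  \col_k (if k == ord0 then a * q 0 0 + b * q 1 0 else c * q 0 0 + d * q 1 0).
Proof.
apply/matrixP => k l; rewrite !mxE (big_ord_recl 1) (big_ord_recl 0) big_ord0.
rewrite !mxE addr0 ord1 /= (_ : lift ord0 ord0 = 1); last exact/val_inj.
by case: ifP.
Qed.

(** The first two Pauli matrices exchange the components; the third keeps them, with opposite
    signs. *)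
Lemma sigma_pE (f : space3 R -> spinor R) x (a b : 'I_3 -> R[i]) :
  (forall j, partial j f x 0 0 = a j) -> (forall j, partial j f x 1 0 = b j) ->
  sigma_p f x = \col_k (- 'i%C * (if k == ord0
     then b 0 - 'i%C * b 1 + a 2 else a 0 + 'i%C * a 1 - b 2)).
Proof.
move=> fa fb.
have fE j : partial j f x = \col_k (if k == ord0 then a j else b j).
  apply/matrixP => k l; rewrite ord1 [RHS]mxE.
  case: k => -[|[|//]] ik; rewrite /= -?fa -?fb; congr (partial _ _ _ _ _);
    exact/val_inj.
rewrite /sigma_p; under eq_bigr do rewrite fE; clear.
rewrite (big_ord_recl 2) (big_ord_recl 1) (big_ord_recl 0) big_ord0 addr0.
rewrite (_ : lift ord0 (lift ord0 ord0) = 2); last exact/val_inj.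
rewrite (_ : lift ord0 ord0 = 1); last exact/val_inj.
rewrite /pauli !(tnth_nth 0) /= !mx2_mul.
apply/matrixP => k l; rewrite !mxE /=.
by case: ifP => _; congr (_ * _); ring.
Qed.

(** For a vector field [V], [(sigma . p)(sigma . V) = -i (div V + i sigma . curl V)]. Here
    [V = psi(|x|^2) x] is radial, hence curl-free, and only its divergence [3 psi + 2 s psi']
    survives. *)
Lemma sigma_p_hedgehog psi dpsi x : is_derive (normsq3 x) 1 psi dpsi ->
  sigma_p (hedgehog psi) x =
  \col_k (if k == ord0 then
            0 +i* - (3 * psi (normsq3 x) + 2 * normsq3 x * dpsi) else 0)%C.
Proof.
move=> d.
have dx v : is_derive x v (fun y => y.1.1) v.1.1 by exact: is_derive_affine.
have dy v : is_derive x v (fun y => y.1.2) v.1.2 by exact: is_derive_affine.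
have dz v : is_derive x v (fun y => y.2) v.2 by exact: is_derive_affine.
have Dx v := @derive_val _ _ _ _ _ _ _ (is_derive_radial_mul d (dx v)).
have Dy v := @derive_val _ _ _ _ _ _ _ (is_derive_radial_mul d (dy v)).
have Dz v := @derive_val _ _ _ _ _ _ _ (is_derive_radial_mul d (dz v)).
have R0 : (fun y => complex.Re (hedgehog psi y 0 0)) =
    (fun y : space3 R => psi (normsq3 y) * y.2).
  by apply/funext => y; rewrite mxE.
have I0 : (fun y => complex.Im (hedgehog psi y 0 0)) = cst 0.
  by apply/funext => y; rewrite mxE.
have R1 : (fun y => complex.Re (hedgehog psi y 1 0)) =
    (fun y : space3 R => psi (normsq3 y) * y.1.1).
  by apply/funext => y; rewrite mxE.
have I1 : (fun y => complex.Im (hedgehog psi y 1 0)) =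
    (fun y : space3 R => psi (normsq3 y) * y.1.2).
  by apply/funext => y; rewrite mxE.
have pE0 j : partial j (hedgehog psi) x 0 0 = (
    (psi (normsq3 x) * (basis3 j).2 + dpsi * (2 * (x.1.1 * (basis3 j).1.1
      + x.1.2 * (basis3 j).1.2 + x.2 * (basis3 j).2)) * x.2) +i* 0)%C.
  by rewrite mxE R0 I0 Dz derive_cst.
have pE1 j : partial j (hedgehog psi) x 1 0 = (
    (psi (normsq3 x) * (basis3 j).1.1 + dpsi * (2 * (x.1.1 * (basis3 j).1.1
      + x.1.2 * (basis3 j).1.2 + x.2 * (basis3 j).2)) * x.1.1) +i*
    (psi (normsq3 x) * (basis3 j).1.2 + dpsi * (2 * (x.1.1 * (basis3 j).1.1
      + x.1.2 * (basis3 j).1.2 + x.2 * (basis3 j).2)) * x.1.2))%C.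
  by rewrite mxE R1 I1 Dx Dy.
rewrite (sigma_pE pE0 pE1).
rewrite /basis3 !(tnth_nth 0) /=.
move: (psi _) => p.
rewrite /normsq3.
apply/matrixP => k l; rewrite !mxE.
case: ifP => _.
  apply/eqP.
  rewrite eq_complex /=; apply/andP; split; apply/eqP; ring.
apply/eqP; rewrite eq_complex /=; apply/andP; split; apply/eqP; ring.
Qed.

End Hedgehog.

(** * Norms, measurability and support of these fields *)

Section HedgehogNorm.
Context {R : realType}.
Implicit Types (x v : space3 R) (psi : R -> R).

Lemma pnorm1_sigma_p_hedgehog psi dpsi x : is_derive (normsq3 x) 1 psi dpsi ->
  pnorm 1 (sigma_p (hedgehog psi) x) =
  `|3 * psi (normsq3 x) + 2 * normsq3 x * dpsi|.
Proof.
move=> d; rewrite (sigma_p_hedgehog d) /pnorm (big_ord_recl 1) (big_ord_recl 0).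
rewrite big_ord0 !mxE /= expr0n !add0r sqrrN addr0 sqrtr_sqr sqrtr0.
by rewrite invr1 !powRr1 ?addr0.
Qed.

Lemma pnormX (p : R) (a : spinor R) : p != 0 ->
  pnorm p a `^ p = complex.Re `|a 0 0| `^ p + complex.Re `|a 1 0| `^ p.
Proof.
move=> p0; rewrite /pnorm -powRrM mulVf// powRr1; last first.
  by apply: sumr_ge0 => k _; exact: powR_ge0.
rewrite (big_ord_recl 1) (big_ord_recl 0) big_ord0 addr0.
by rewrite (_ : lift ord0 ord0 = 1) //; exact/val_inj.
Qed.

Lemma pnormX_hedgehog (p : R) psi x : p != 0 ->
  pnorm p (hedgehog psi x) `^ p = `|psi (normsq3 x) * x.2| `^ p +
    Num.sqrt ((psi (normsq3 x) * x.1.1) ^+ 2 +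
              (psi (normsq3 x) * x.1.2) ^+ 2) `^ p.
Proof.
by move=> p0; rewrite pnormX// !mxE/= expr0n addr0 sqrtr_sqr.
Qed.

Lemma measurable_pnormX_hedgehog (p : R) psi : p != 0 ->
  elementary (fun x => psi (normsq3 x)) ->
  measurable_fun setT (fun x => pnorm p (hedgehog psi x) `^ p).
Proof.
move=> p0 epsi.
have mx : measurable_fun setT (fun x => psi (normsq3 x) * x.1.1).
  apply: elementary_measurable; apply: elementary_mul => //.
  exact: elementary_x.
have my : measurable_fun setT (fun x => psi (normsq3 x) * x.1.2).
  apply: elementary_measurable; apply: elementary_mul => //.
  exact: elementary_y.
have mz : measurable_fun setT (fun x => psi (normsq3 x) * x.2).
  apply: elementary_measurable; apply: elementary_mul => //.
  exact: elementary_z.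
rewrite (_ : (fun _ => _) = (fun x => `|psi (normsq3 x) * x.2| `^ p +
    Num.sqrt ((psi (normsq3 x) * x.1.1) ^+ 2 +
              (psi (normsq3 x) * x.1.2) ^+ 2) `^ p)); last first.
  by apply/funext => x; rewrite pnormX_hedgehog.
have mp := @measurable_powR R p.
apply: measurable_funD.
  exact: measurableT_comp mp (measurableT_comp (@normr_measurable R setT) mz).
apply: (measurableT_comp mp).
apply: (@measurableT_comp _ _ _ _ _ _ (@Num.sqrt R)).
  by apply: continuous_measurable_fun; exact: sqrt_continuous.
by apply: measurable_funD; exact: measurable_funX.
Qed.

(** The upper component alone is enough for the lower bound, since [z] is comparable to [|x|] on the
    dyadic cubes. *)
Lemma pnormX_hedgehog_ge (p : R) psi x : p != 0 ->
  `|psi (normsq3 x) * x.2| `^ p <= pnorm p (hedgehog psi x) `^ p.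
Proof. by move=> p0; rewrite pnormX_hedgehog// lerDl powR_ge0. Qed.

(** The unit ball lies in the compact cube [[-1, 1]^3], which, being closed, also contains the
    closure of the nonvanishing set. *)
Lemma compact_support_le (u : space3 R -> R[i]) :
  (forall x, 1 <= normsq3 x -> u x = 0) -> compact_support u.
Proof.
move=> u0; set K : set (space3 R) := (`[-1, 1] `*` `[-1, 1]) `*` `[-1, 1].
have cK : compact K.
  by do !apply: compact_setX => //; exact: segment_compact.
apply: (subclosed_compact _ cK); first exact: closed_closure.
have hK : hausdorff_space (space3 R) by exact: norm_hausdorff.
rewrite [X in _ `<=` X](_ : K = closure K); last first.
  by apply/closure_id; exact: compact_closed.
apply: closure_subset => -[[a b] c]/= /eqP ux0.
have : normsq3 (a, b, c) < 1.
  by rewrite ltNge; apply/negP => /u0.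
rewrite /normsq3/= => s1.
by split; [split|]; rewrite /= in_itv/=; apply/andP; split; nra.
Qed.

Lemma C0_infty_hedgehog psi : elementary (fun x => psi (normsq3 x)) ->
  (forall s, 1 <= s -> psi s = 0) -> C0_infty (hedgehog psi).
Proof.
move=> epsi psi0 k; split; last first.
  apply: compact_support_le => x /psi0 px; rewrite mxE px !mul0r.
  by case: ifP.
case: k => -[|[|//]] ik; split.
- rewrite (_ : (fun _ => _) = (fun x => psi (normsq3 x) * x.2)).
    by apply/elementary_smooth/elementary_mul => //; exact: elementary_z.
  by apply/funext => x; rewrite mxE.
- rewrite (_ : (fun _ => _) = (fun x => 0)).
    by apply/elementary_smooth; exact: elementary_cst.
  by apply/funext => x; rewrite mxE.
- rewrite (_ : (fun _ => _) = (fun x => psi (normsq3 x) * x.1.1)).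
    by apply/elementary_smooth/elementary_mul => //; exact: elementary_x.
  by apply/funext => x; rewrite mxE.
- rewrite (_ : (fun _ => _) = (fun x => psi (normsq3 x) * x.1.2)).
    by apply/elementary_smooth/elementary_mul => //; exact: elementary_y.
  by apply/funext => x; rewrite mxE.
Qed.

End HedgehogNorm.

(** * The regularized, truncated profile and its pointwise bounds *)

Section Profile.
Context {R : realType}.
Implicit Types (eta s t rho : R) (x : space3 R).

(** Since [s] stands for [|x|^2], pairing [s^2] with [eta^4] makes [eta] a length. The cutoff is the
    bump [exp(-1/(1 - s^2))], supported in [|s| <= 1]. *)
Definition profile eta s : R :=
  invroot4 (s ^+ 2 + eta ^+ 4) ^+ 3 * flat 0 (1 - s ^+ 2).

(** The two terms come from the product rule; [flat 2] is the derivative of [flat 0]. *)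
Definition dprofile eta s : R :=
  - (3 / 2) * s * invroot4 (s ^+ 2 + eta ^+ 4) ^+ 7 * flat 0 (1 - s ^+ 2)
  - 2 * s * invroot4 (s ^+ 2 + eta ^+ 4) ^+ 3 * flat 2 (1 - s ^+ 2).

Lemma sqrD_pow4_gt0 eta s : 0 < eta -> 0 < s ^+ 2 + eta ^+ 4.
Proof. by move=> eta0; rewrite ltr_wpDl ?sqr_ge0 ?exprn_gt0. Qed.

Lemma elementary_invroot4_normsq3 eta : 0 < eta ->
  elementary (fun x => invroot4 (normsq3 x ^+ 2 + eta ^+ 4)).
Proof.
move=> eta0.
apply: (@elementary_invroot4 _ (fun x => normsq3 x ^+ 2 + eta ^+ 4)).
  by move=> x; exact: sqrD_pow4_gt0.
apply: elementary_add; last exact: elementary_cst.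
exact/elementary_exprn/elementary_normsq3.
Qed.

Lemma elementary_flat_normsq3 n :
  elementary (fun x : space3 R => flat n (1 - normsq3 x ^+ 2)).
Proof.
apply: (@elementary_flat _ n (fun x => 1 - normsq3 x ^+ 2)).
rewrite (_ : (fun _ => _) = (fun x => 1 + -1 * normsq3 x ^+ 2)).
  apply: elementary_add; first exact: elementary_cst.
  apply: elementary_mul; first exact: elementary_cst.
  exact/elementary_exprn/elementary_normsq3.
by apply/funext => x; rewrite mulN1r.
Qed.

Lemma elementary_profile eta : 0 < eta ->
  elementary (fun x => profile eta (normsq3 x)).
Proof.
move=> eta0; apply: elementary_mul; last exact: elementary_flat_normsq3.
exact/elementary_exprn/elementary_invroot4_normsq3.
Qed.

Lemma elementary_dprofile eta : 0 < eta ->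
  elementary (fun x => dprofile eta (normsq3 x)).
Proof.
move=> eta0; pose e x := invroot4 (normsq3 x ^+ 2 + eta ^+ 4).
have ee : elementary e := elementary_invroot4_normsq3 eta0.
rewrite (_ : (fun _ => _) = (fun x =>
    - (3 / 2) * normsq3 x * e x ^+ 7 * flat 0 (1 - normsq3 x ^+ 2) +
    - 2 * normsq3 x * e x ^+ 3 * flat 2 (1 - normsq3 x ^+ 2))); last first.
  by apply/funext => x; rewrite /dprofile !mulNr.
have ec c : elementary (fun x => c * normsq3 x).
  by apply: elementary_mul; [exact: elementary_cst|exact: elementary_normsq3].
by apply: elementary_add; (apply: elementary_mul;
  [apply: elementary_mul => //; exact: elementary_exprn|
   exact: elementary_flat_normsq3]).
Qed.

Lemma is_derive_profile eta s : 0 < eta ->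
  is_derive s 1 (profile eta) (dprofile eta s).
Proof.
move=> eta0.
have ds : is_derive s 1 (fun t => t * t) (2 * s).
  apply: is_derive_eq (is_deriveM (is_derive_id s 1) (is_derive_id s 1)) _.
  by rewrite /GRing.scale/=; ring.
have dq : is_derive s 1 (fun t => t * t + eta ^+ 4) (2 * s).
  apply: is_derive_eq (is_deriveD ds (is_derive_cst (eta ^+ 4) s 1)) _.
  by rewrite addr0.
have db : is_derive s 1 (fun t => 1 - t * t) (- (2 * s)).
  apply: is_derive_eq (is_deriveB (is_derive_cst (1 : R) s 1) ds) _.
  by rewrite sub0r.
have de := is_derive1_comp (g := fun t => t * t + eta ^+ 4)
  (is_derive_invroot4 (sqrD_pow4_gt0 s eta0)) dq.
have dB := is_derive1_comp (g := fun t => 1 - t * t)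
  (is_derive_flat 0 (1 - s * s)) db.
have := is_deriveM (is_deriveM de (is_deriveM de de)) dB.
rewrite (_ : _ * _ = profile eta); last first.
  by apply/funext => t; rewrite /profile /= !expr2 !exprS expr0 !mulr1.
move=> H; apply: is_derive_eq H _.
rewrite /dprofile /GRing.scale/= !fctE /= -!expr2 mul0r subr0.
by move: (invroot4 _) (flat _ _) (flat _ _) => *; field.
Qed.

(** This majorant factors over the coordinates, so that Tonelli reduces its integral to
    one-dimensional ones that are independent of [eta]. *)
Definition poisson3 eta x : R :=
  eta / (x.1.1 ^+ 2 + eta ^+ 2) * (eta / (x.1.2 ^+ 2 + eta ^+ 2)) *
  (eta / (x.2 ^+ 2 + eta ^+ 2)).

Lemma poisson3E eta x : poisson3 eta x = eta ^+ 3 /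
  ((x.1.1 ^+ 2 + eta ^+ 2) * (x.1.2 ^+ 2 + eta ^+ 2) * (x.2 ^+ 2 + eta ^+ 2)).
Proof. by rewrite /poisson3 !invfM; ring. Qed.

Lemma normsq3_ge0 x : 0 <= normsq3 x.
Proof. by rewrite /normsq3 -!expr2 !addr_ge0 ?sqr_ge0. Qed.

(** Each factor [x_i^2 + eta^2] of the denominator is at most [|x|^2 + eta^2]. *)
Lemma le_poisson3 eta x : 0 < eta ->
  eta ^+ 3 / (normsq3 x + eta ^+ 2) ^+ 3 <= poisson3 eta x.
Proof.
move=> eta0; rewrite poisson3E ler_pM2l ?exprn_gt0//.
have e20 : 0 < eta ^+ 2 by rewrite exprn_gt0.
have p (t : R) : 0 < t ^+ 2 + eta ^+ 2 by rewrite ltr_wpDl ?sqr_ge0.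
have r0 : 0 < normsq3 x + eta ^+ 2 by rewrite ltr_wpDl ?normsq3_ge0.
have P0 := mulr_gt0 (mulr_gt0 (p x.1.1) (p x.1.2)) (p x.2).
rewrite lef_pV2 ?posrE ?exprn_gt0//.
have a0 := sqr_ge0 x.1.1; have b0 := sqr_ge0 x.1.2; have c0 := sqr_ge0 x.2.
rewrite [leRHS]exprSr [X in _ <= X * _]expr2; apply: ler_pM => //.
- by rewrite mulr_ge0 ?ltW.
- exact: ltW.
- by apply: ler_pM; rewrite ?(ltW (p _))//; rewrite /normsq3; lra.
- by rewrite /normsq3; lra.
Qed.

Lemma profile_eq0 eta s : 1 <= s -> profile eta s = 0.
Proof.
by move=> s1; rewrite /profile flat_eq0 ?mulr0// subr_le0 exprn_ege1.
Qed.

(** The regularization leaves a term concentrated at scale [eta], at most [3 * 8] times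
    [poisson3 eta]; the cutoff leaves one at scale 1, at most [4 * 16] times [poisson3 1]. The
    constant 64 covers both. *)
Lemma divergence_profile_le eta x : 0 < eta ->
  `|3 * profile eta (normsq3 x) + 2 * normsq3 x * dprofile eta (normsq3 x)| <=
  64 * (poisson3 1 x + poisson3 eta x).
Proof.
move=> eta0; set s := normsq3 x.
have s0 : 0 <= s := normsq3_ge0 x.
have q0 := sqrD_pow4_gt0 s eta0.
rewrite /profile /dprofile; set e := invroot4 _.
have e0 : 0 < e by exact: invroot4_gt0.
have e_ge0 := ltW e0; have eta_ge0 := ltW eta0.
have e4 : e ^+ 4 * (s ^+ 2 + eta ^+ 4) = 1.
  by rewrite invroot4X4// mulVf// gt_eqF.
set B := flat 0 _; set F := flat 2 _.
have B0 : 0 <= B := flat_ge0 _ _; have B1 : B <= 1 := flat0_le1 _.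
have F0 : 0 <= F := flat_ge0 _ _.
(* The cancellation for the fundamental solution: writing [e^3 = e^7 (s^2 + eta^4)], the [s^2] part
   is removed by the derivative of [e^3], and only [eta^4 e^7] remains. *)
have -> : 3 * (e ^+ 3 * B) + 2 * s * (- (3 / 2) * s * e ^+ 7 * B -
      2 * s * e ^+ 3 * F) =
    3 * (eta ^+ 4 * e ^+ 7) * B - 4 * (s ^+ 2 * e ^+ 3) * F.
  have e3 : e ^+ 3 = e ^+ 7 * (s ^+ 2 + eta ^+ 4).
    by rewrite -[LHS]mul1r -e4; ring.
  by rewrite {1}e3; field.
have se : s ^+ 2 * e ^+ 4 <= 1.
  by rewrite -e4 mulrC ler_pM2l ?exprn_gt0// lerDl exprn_ge0.
have etae : eta * e <= 1.
  rewrite -(@ler_pXn2r _ 4) ?nnegrE ?mulr_ge0// expr1n exprMn.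
  by rewrite -e4 mulrC ler_pM2l ?exprn_gt0// lerDr sqr_ge0.
set r := s + eta ^+ 2.
have r0 : 0 < r by rewrite ltr_wpDl ?exprn_gt0.
have r_ge0 := ltW r0.
(* Its square is at most 2, because [(s + eta^2)^2 <= 2 (s^2 + eta^4)]. *)
have yr : e ^+ 2 * r <= 2.
  rewrite -(@ler_pXn2r _ 2) ?nnegrE ?mulr_ge0 ?sqr_ge0//.
  rewrite exprMn -exprM.
  have r2 : r ^+ 2 <= 2 * (s ^+ 2 + eta ^+ 4).
    have := sqr_ge0 (s - eta ^+ 2); rewrite /r; nra.
  apply: le_trans (ler_wpM2l (exprn_ge0 4 e_ge0) r2) _.
  by rewrite mulrCA e4; lra.
(* [eta^4 e^7 r^3 = eta^3 (eta e) (e^2 r)^3], with [eta e <= 1], [e^2 r <= 2]. *)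
have first : eta ^+ 4 * e ^+ 7 <= 8 * poisson3 eta x.
  have k : 8 * (eta ^+ 3 / (s + eta ^+ 2) ^+ 3) <= 8 * poisson3 eta x.
    by rewrite ler_pM2l ?le_poisson3.
  apply: le_trans k; rewrite -/r mulrA ler_pdivlMr ?exprn_gt0//.
  have -> : eta ^+ 4 * e ^+ 7 * r ^+ 3 =
    (eta * e) * ((e ^+ 2 * r) ^+ 3 * eta ^+ 3) by ring.
  have y3 : (e ^+ 2 * r) ^+ 3 <= 8.
    have -> : 8 = 2 ^+ 3 :> R by ring.
    by rewrite lerXn2r ?nnegrE ?mulr_ge0 ?sqr_ge0.
  apply: le_trans (ler_piMl _ etae) _.
    by rewrite mulr_ge0 ?exprn_ge0 ?mulr_ge0 ?sqr_ge0.
  by rewrite ler_pM2r ?exprn_gt0.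
(* Outside the unit ball [F = 0]. Inside, [s^2 e^3 <= 1] and [F <= 2], while [poisson3 1 >= 1/8];
   whence [16 = 2 * 8]. *)
have second : s ^+ 2 * e ^+ 3 * F <= 16 * poisson3 1 x.
  have k0 : 0 <= poisson3 1 x.
    by rewrite poisson3E divr_ge0 ?expr1n// !mulr_ge0 ?addr_ge0 ?sqr_ge0.
  have [s1|s1] := leP 1 s.
    have -> : F = 0 by rewrite /F flat_eq0// subr_le0 exprn_ege1.
    by rewrite mulr0 mulr_ge0.
  have F2 : F <= 2 := flat2_le2 _.
  have h : s ^+ 2 * e ^+ 3 <= 1.
    rewrite -(@ler_pXn2r _ 4) ?nnegrE ?mulr_ge0 ?exprn_ge0// expr1n.
    have -> : (s ^+ 2 * e ^+ 3) ^+ 4 = (s ^+ 2 * e ^+ 4) ^+ 3 * s ^+ 2 by ring.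
    have s_le1 := ltW s1.
    have se0 : 0 <= s ^+ 2 * e ^+ 4 by rewrite mulr_ge0 ?exprn_ge0.
    by apply: mulr_ile1; rewrite ?exprn_ile1 ?exprn_ge0.
  have k8 : 8^-1 <= poisson3 1 x.
    apply: le_trans (le_poisson3 x ltr01).
    have s_le1 := ltW s1.
    have s1_gt0 : 0 < s + 1 by lra.
    have s1_le8 : (s + 1) ^+ 3 <= 8.
      have -> : 8 = 2 ^+ 3 :> R by ring.
      by rewrite lerXn2r ?nnegrE ?(ltW s1_gt0)//; lra.
    by rewrite !expr1n mul1r lef_pV2 ?posrE ?exprn_gt0.
  have : s ^+ 2 * e ^+ 3 * F <= 1 * 2.
    by apply: ler_pM => //; rewrite mulr_ge0 ?exprn_ge0.
  by move=> /le_trans; apply; lra.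
have first0 : 0 <= eta ^+ 4 * e ^+ 7 by rewrite mulr_ge0 ?exprn_ge0.
have firstB : eta ^+ 4 * e ^+ 7 * B <= eta ^+ 4 * e ^+ 7 by rewrite ler_piMr.
have second0 : 0 <= s ^+ 2 * e ^+ 3 * F.
  by rewrite !mulr_ge0 ?exprn_ge0.
have firstB0 : 0 <= eta ^+ 4 * e ^+ 7 * B by rewrite mulr_ge0.
rewrite -!(mulrA 3) -!(mulrA 4).
move: (eta ^+ 4 * e ^+ 7) first first0 firstB firstB0 => X *.
rewrite ler_norml; apply/andP; split; lra.
Qed.

(** On the cube [s <= 3 rho^2], so [s^2 + eta^4 <= 10 rho^4 <= (2 rho)^4] and the singular factor is
    at least [(2 rho)^-3]. As [rho <= 1/2], also [s <= 3/4], so [1 - s^2 >= 7/16 > 1/3] and the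
    cutoff is at least [exp(-3)]. Multiplying by [z > rho/2] gives the constant 1/16. *)
Lemma profile_mul_ge eta rho x : 0 < eta -> eta <= rho -> rho <= 2^-1 ->
  rho / 2 < x.1.1 <= rho -> rho / 2 < x.1.2 <= rho -> rho / 2 < x.2 <= rho ->
  expR (- 3) / 16 / rho ^+ 2 <= profile eta (normsq3 x) * x.2.
Proof.
move=> eta0 eta_rho rho2 /andP[x1 x1'] /andP[x2 x2'] /andP[x3 x3'].
have rho0 : 0 < rho by rewrite (lt_le_trans eta0).
have rho_ge0 := ltW rho0.
set s := normsq3 x.
have s0 : 0 <= s := normsq3_ge0 x.
have sr : s <= 3 * rho ^+ 2.
  have sq t : rho / 2 < t -> t <= rho -> t * t <= rho ^+ 2.
    by move=> t1 t2; rewrite expr2 ler_pM//; lra.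
  by rewrite /s /normsq3; have := sq _ x1 x1'; have := sq _ x2 x2';
    have := sq _ x3 x3'; lra.
have rr : rho ^+ 2 <= 4^-1.
  have -> : 4^-1 = 2^-1 ^+ 2 :> R by field.
  by rewrite lerXn2r ?nnegrE.
have s2 : s ^+ 2 <= 9 / 16.
  have -> : 9 / 16 = (3 / 4) ^+ 2 :> R by field.
  by rewrite lerXn2r ?nnegrE//; lra.
rewrite /profile; set e := invroot4 _.
have q0 := sqrD_pow4_gt0 s eta0.
have e0 : 0 < e by exact: invroot4_gt0.
have e_ge0 := ltW e0; have eta_ge0 := ltW eta0.
have ge_e : (2 * rho)^-1 <= e.
  rewrite -(@ler_pXn2r _ 4) ?nnegrE ?invr_ge0 ?mulr_ge0//.
  rewrite invroot4X4// exprVn lef_pV2 ?posrE ?exprn_gt0 ?mulr_gt0//.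
  have h1 : s ^+ 2 <= (3 * rho ^+ 2) ^+ 2.
    by rewrite lerXn2r ?nnegrE ?mulr_ge0 ?sqr_ge0.
  have h2 : eta ^+ 4 <= rho ^+ 4 by rewrite lerXn2r ?nnegrE.
  have -> : (2 * rho) ^+ 4 = 16 * rho ^+ 4 by ring.
  have h3 : (3 * rho ^+ 2) ^+ 2 = 9 * rho ^+ 4 by ring.
  have : 0 <= rho ^+ 4 by rewrite exprn_ge0.
  rewrite h3 in h1; lra.
have geB : expR (- 3) <= flat 0 (1 - s ^+ 2).
  have p : 0 < 1 - s ^+ 2 by lra.
  rewrite /flat p expr0 invr1 mul1r ler_expR lerN2 -[3]invrK lef_pV2 ?posrE//.
  lra.
have -> : expR (- 3) / 16 / rho ^+ 2 =
    (2 * rho)^-1 ^+ 3 * expR (- 3) * (rho / 2).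
  by field; rewrite gt_eqF.
have e3 : (2 * rho)^-1 ^+ 3 <= e ^+ 3.
  by rewrite lerXn2r ?nnegrE ?invr_ge0 ?mulr_ge0.
have i0 : 0 <= (2 * rho)^-1 ^+ 3 by rewrite exprn_ge0// invr_ge0 mulr_ge0.
apply: ler_pM.
- by rewrite mulr_ge0 ?expR_ge0.
- by rewrite divr_ge0.
- by apply: ler_pM; rewrite ?expR_ge0.
- exact: ltW.
Qed.

End Profile.

(** * Poisson kernels and integration over product measures *)

Section Integrals.
Context {R : realType}.
Implicit Types (eta : R) (x : space3 R).
Local Notation mu := (@lebesgue_measure R).

Definition poisson eta (t : R) : R := eta / (t ^+ 2 + eta ^+ 2).

Lemma poisson_ge0 eta t : 0 < eta -> 0 <= poisson eta t.
Proof. by move=> eta0; rewrite divr_ge0 ?addr_ge0 ?sqr_ge0// ltW. Qed.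

Lemma continuous_poisson eta : 0 < eta -> continuous (poisson eta).
Proof.
move=> eta0 t; apply: cvgM; first exact: cvg_cst.
apply: cvgV; first by rewrite gt_eqF// ltr_wpDl ?sqr_ge0 ?exprn_gt0.
by apply: cvgD; [exact: exprn_continuous|exact: cvg_cst].
Qed.

Lemma is_derive_atan_div eta (t : R) : 0 < eta ->
  is_derive t (1 : R) (fun s => atan (s / eta)) (poisson eta t).
Proof.
move=> eta0.
have d : is_derive t (1 : R) (fun s : R => s / eta) eta^-1.
  rewrite (_ : (fun s => _) = eta^-1 \*: id); last first.
    by apply/funext => s; rewrite mulrC.
  apply: is_derive_eq; exact: mulr1.
apply: is_derive_eq (is_derive1_comp (is_derive1_atan _) d) _.
rewrite /poisson; field.
by rewrite (gt_eqF eta0) andbT gt_eqF// ltr_wpDl ?sqr_ge0 ?exprn_gt0.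
Qed.

(** The kernel is even with antiderivative [atan (t / eta)], so each half-line contributes [pi / 2]
    whatever the width. *)
Lemma integral_poisson eta : 0 < eta ->
  (\int[mu]_t (poisson eta t)%:E = pi%:E)%E.
Proof.
move=> eta0; have k0 t := poisson_ge0 t eta0.
have ck := continuous_poisson eta0.
rewrite ge0_symfun_integralT//; last by move=> t /=; rewrite /poisson sqrrN.
rewrite -set_itvcy.
have cF t : {for t, continuous (fun s : R => atan (s / eta))}.
  apply/differentiable_continuous/derivable1_diffP.
  exact: (@ex_derive _ _ _ _ _ _ _ (is_derive_atan_div t eta0)).
rewrite (@ge0_continuous_FTC2y _ _ (fun s => atan (s / eta)) _ (pi / 2)).
- by rewrite mul0r atan0 sube0 -EFinM; congr EFin; field.
- by move=> t _.
- exact: (continuous_subspaceT ck).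
- have h : (fun s : R => s / eta) s @[s --> +oo] --> +oo.
    by apply: gt0_cvgMly; rewrite ?invr_gt0//; exact: cvg_id.
  exact: cvg_comp h (@cvgy_atan R).
- move=> t _; exact: (@ex_derive _ _ _ _ _ _ _ (is_derive_atan_div t eta0)).
- by apply: cvg_at_right_filter; exact: cF.
- move=> t _; rewrite derive1E.
  exact: (@derive_val _ _ _ _ _ _ _ (is_derive_atan_div t eta0)).
Qed.

Lemma sigma_finite_prod d1 d2 (T1 : measurableType d1)
    (T2 : measurableType d2) (m1 : {sigma_finite_measure set T1 -> \bar R})
    (m2 : {sigma_finite_measure set T2 -> \bar R}) :
  sigma_finite setT (m1 \x m2)%E.
Proof.
have /sigma_finiteP[F [TF ndF Foo]] := sigma_finiteT m1.
have /sigma_finiteP[G [TG ndG Goo]] := sigma_finiteT m2.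
(* One index serves both exhausting sequences: they are nondecreasing, so a point of [F n] times
   [G k] lies in the rectangle of index [maxn n k]. *)
exists (fun n => F n `*` G n).
  apply/esym/seteqP; split=> // -[x y] _.
  have [n _ Fx] : (\bigcup_i F i) x by rewrite -TF.
  have [k _ Gy] : (\bigcup_i G i) y by rewrite -TG.
  exists (maxn n k) => //; split => /=.
    by apply: (subsetPset _ _ (ndF _ _ (leq_maxl n k))).
  by apply: (subsetPset _ _ (ndG _ _ (leq_maxr n k))).
move=> k; have [mF Fk] := Foo k; have [mG Gk] := Goo k.
split; first exact: measurableX.
by rewrite product_measure1E// lte_mul_pinfty// ge0_fin_numE.
Qed.

(* For [m1 \x m2] itself, inference of a sigma-finite structure only tries the
   library's instance for subprobabilities. *)
Definition product_sigma_finite d1 d2 (T1 : measurableType d1)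
    (T2 : measurableType d2) (m1 : {sigma_finite_measure set T1 -> \bar R})
    (m2 : {sigma_finite_measure set T2 -> \bar R}) :
  set (T1 * T2) -> \bar R := (m1 \x m2)%E.

HB.instance Definition _ d1 d2 (T1 : measurableType d1)
    (T2 : measurableType d2) (m1 : {sigma_finite_measure set T1 -> \bar R})
    (m2 : {sigma_finite_measure set T2 -> \bar R}) :=
  Measure.on (product_sigma_finite m1 m2).

HB.instance Definition _ d1 d2 (T1 : measurableType d1)
    (T2 : measurableType d2) (m1 : {sigma_finite_measure set T1 -> \bar R})
    (m2 : {sigma_finite_measure set T2 -> \bar R}) :=
  Measure_isSigmaFinite.Build _ _ _ (product_sigma_finite m1 m2)
    (sigma_finite_prod m1 m2).

Lemma ge0_integral_prodM d1 d2 (T1 : measurableType d1)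
    (T2 : measurableType d2) (m1 : {sigma_finite_measure set T1 -> \bar R})
    (m2 : {sigma_finite_measure set T2 -> \bar R}) (g : T1 -> R) (h : T2 -> R) :
  (forall t, 0 <= g t) -> (forall t, 0 <= h t) ->
  measurable_fun setT g -> measurable_fun setT h ->
  (\int[m1 \x m2]_z (g z.1 * h z.2)%:E =
   \int[m1]_t (g t)%:E * \int[m2]_t (h t)%:E)%E.
Proof.
move=> g0 h0 mg mh.
have mgh : measurable_fun setT (fun z : T1 * T2 => (g z.1 * h z.2)%:E).
  apply/measurable_EFinP/measurable_funM.
    exact: measurableT_comp mg measurable_fst.
  exact: measurableT_comp mh measurable_snd.
rewrite (fubini_tonelli1 _ mgh); last first.
  by move=> z; rewrite lee_fin mulr_ge0.
rewrite /fubini_F/= -ge0_integralZr//; last 3 first.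
- exact/measurable_EFinP.
- by move=> t _; rewrite lee_fin.
- by apply: integral_ge0 => t _; rewrite lee_fin.
apply: eq_integral => t _.
under eq_integral do rewrite EFinM.
rewrite ge0_integralZl ?lee_fin//; first exact/measurable_EFinP.
by move=> u _; rewrite lee_fin.
Qed.

Lemma integral_poisson3 eta : 0 < eta ->
  (\int[lebesgue3 R]_x (poisson3 eta x)%:E = (pi ^+ 3)%:E)%E.
Proof.
move=> eta0.
have mk : measurable_fun setT (poisson eta).
  by apply: continuous_measurable_fun; exact: continuous_poisson.
have k0 t := poisson_ge0 t eta0.
pose k2 (z : R * R) : R := poisson eta z.1 * poisson eta z.2.
have k20 z : 0 <= k2 z by rewrite mulr_ge0.
have mk2 : measurable_fun setT k2.
  apply: measurable_funM; first exact: measurableT_comp mk measurable_fst.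
  exact: measurableT_comp mk measurable_snd.
have E2 := ge0_integral_prodM mu mu k0 k0 mk mk.
(* The third variable is split off first; the named product carries the sigma-finite structure and
   unfolds to the measure inside [lebesgue3]. *)
have E3 := ge0_integral_prodM (product_sigma_finite mu mu) mu k20 k0 mk2 mk.
rewrite integral_poisson // in E2 E3.
transitivity (pi%:E * pi%:E * pi%:E : \bar R)%E.
  by rewrite -E2; exact: E3.
by rewrite -!EFinM; congr EFin; ring.
Qed.

End Integrals.

(** * Dyadic lower bound for [f] and uniform upper bound for [(sigma . p) f] *)

Section LowerBound.
Context {R : realType}.
Implicit Types (eta rho : R) (x : space3 R).
Local Notation mu := (@lebesgue_measure R).

Definition cube (a b : R) : set (R * R * R) :=
  (`]a, b] `*` `]a, b]) `*` `]a, b].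

Lemma measurable_cube (a b : R) : measurable (cube a b).
Proof. by apply: measurableX => //; exact: measurableX. Qed.

Lemma lebesgue3_cube (a b : R) : a < b ->
  (lebesgue3 R) (cube a b) = ((b - a) ^+ 3)%:E.
Proof.
move=> ab; have I : mu `]a, b] = (b - a)%:E.
  by rewrite lebesgue_measure_itv/= lte_fin ab EFinB.
have P : (mu \x mu)%E (`]a, b] `*` `]a, b]) = ((b - a) * (b - a))%:E.
  transitivity (mu `]a, b] * mu `]a, b])%E; last by rewrite I.
  exact: product_measure1E.
transitivity ((mu \x mu)%E (`]a, b] `*` `]a, b]) * mu `]a, b])%E; last first.
  by rewrite P I -EFinM; congr EFin; ring.
by apply: product_measure1E => //; exact: measurableX.
Qed.

Lemma integral_cube_ge (f : R * R * R -> R) (c a b : R) : a < b -> 0 <= c ->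
  measurable_fun setT f -> (forall x, cube a b x -> c <= f x) ->
  ((c * (b - a) ^+ 3)%:E <= \int[lebesgue3 R]_(x in cube a b) (f x)%:E)%E.
Proof.
move=> ab c0 mf cf; rewrite EFinM -lebesgue3_cube// -integral_cst//; last first.
  exact: measurable_cube.
apply: ge0_le_integral => //.
- exact: measurable_cube.
- by apply/measurable_EFinP; exact: measurable_funTS.
Qed.

Definition dyadic_cube (k : nat) := cube (2^-1 ^+ k.+2) (2^-1 ^+ k.+1).

(** The last coordinate alone separates the cubes, as the half-open intervals []2^(-k-2), 2^(-k-1)]]
    are disjoint. *)
Lemma trivIset_dyadic_cube (D : set nat) : trivIset D dyadic_cube.
Proof.
move=> i j _ _ [x [[_ xi] [_ xj]]].
move: xi xj; rewrite /= !in_itv/= => /andP[i1 i2] /andP[j1 j2].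
have h k l (t : R) : 2^-1 ^+ k.+2 < t -> t <= 2^-1 ^+ l.+1 -> (l <= k)%N.
  move=> t1 t2; have := lt_le_trans t1 t2.
  by rewrite ltr_iXn2l ?invr_gt0//; lra.
by apply/eqP; rewrite eqn_leq (h _ _ _ j1 i2) (h _ _ _ i1 j2).
Qed.

(** The lower bound [c / rho^2] for [|f|], raised to the power 3/2, is [c^(3/2) / rho^3]; times the
    volume [(rho/2)^3] it gives a constant free of [rho]. This scale invariance makes the integral
    diverge. *)
Definition cube_mass : R := (expR (- 3) / 16) `^ (3 / 2) / 8.

Lemma cube_mass_gt0 : 0 < cube_mass.
Proof. by rewrite divr_gt0// powR_gt0// divr_gt0// expR_gt0. Qed.

Lemma integral_dyadic_cube_ge (N k : nat) : (k < N)%N ->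
  (cube_mass%:E <= \int[lebesgue3 R]_(x in dyadic_cube k)
    (pnorm (3 / 2) (hedgehog (profile (2^-1 ^+ N)) x) `^ (3 / 2))%:E)%E.
Proof.
move=> kN; set eta : R := 2^-1 ^+ N; set rho : R := 2^-1 ^+ k.+1.
have eta0 : 0 < eta by rewrite exprn_gt0.
have rho0 : 0 < rho by rewrite exprn_gt0.
have half : 2^-1 ^+ k.+2 = rho / 2 by rewrite /rho exprSr.
have p0 : 3 / 2 != 0 :> R by lra.
have -> : cube_mass = (expR (- 3) / 16) `^ (3 / 2) / rho ^+ 3 *
    (rho - 2^-1 ^+ k.+2) ^+ 3.
  rewrite /cube_mass half; set c := powR _ _; field.
  by rewrite gt_eqF.
rewrite /dyadic_cube -/rho; apply: integral_cube_ge.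
- rewrite half; lra.
- by rewrite divr_ge0 ?powR_ge0// ltW// exprn_gt0.
- apply: measurable_pnormX_hedgehog => //; exact: elementary_profile.
move=> x [[/= x1 x2] x3]; rewrite !in_itv/= half in x1 x2 x3.
apply: le_trans (pnormX_hedgehog_ge _ _ p0).
(* Here [k < N] is used: [eta = 2^-N] and [rho = 2^-(k+1)]. *)
have eta_rho : eta <= rho.
  by rewrite /eta /rho ler_iXn2l ?invr_gt0//; lra.
have rho2 : rho <= 2^-1.
  by rewrite /rho exprS ler_piMr// exprn_ile1//; lra.
have lb := profile_mul_ge eta0 eta_rho rho2 x1 x2 x3.
have c0 : 0 <= expR (- 3) / 16 :> R by rewrite divr_ge0 ?expR_ge0.
have -> : (expR (- 3) / 16) `^ (3 / 2) / rho ^+ 3 =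
    (expR (- 3) / 16 / rho ^+ 2) `^ (3 / 2).
  rewrite [RHS]powRM ?invr_ge0 ?sqr_ge0//; congr (_ * _).
  have ir0 : 0 <= rho^-1 by rewrite invr_ge0 ltW.
  transitivity (rho^-1 `^ (2%:R * (3 / 2))).
    rewrite -exprVn -(powR_mulrn 3 ir0); congr (_ `^ _); lra.
  by rewrite powRrM (powR_mulrn 2 ir0) exprVn.
have lb0 : 0 <= expR (- 3) / 16 / rho ^+ 2 by rewrite divr_ge0 ?sqr_ge0.
apply: ge0_ler_powR; rewrite ?nnegrE//.
exact: le_trans lb (ler_norm _).
Qed.

Lemma integral_dyadic_cubes_ge (g : R * R * R -> R) (c : R) (N : nat) :
  measurable_fun setT g -> (forall x, 0 <= g x) ->
  (forall k, (k < N)%N ->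
    (c%:E <= \int[lebesgue3 R]_(x in dyadic_cube k) (g x)%:E)%E) ->
  ((N%:R * c)%:E <= \int[lebesgue3 R]_x (g x)%:E)%E.
Proof.
move=> mg g0 cg.
have mf : measurable_fun setT (EFin \o g) by exact/measurable_EFinP.
pose U := \big[setU/set0]_(k <- iota 0 N) dyadic_cube k.
have mD k : measurable (dyadic_cube k) by exact: measurable_cube.
have mU : measurable U by exact: bigsetU_measurable.
apply: (@le_trans _ _ (\int[lebesgue3 R]_(x in U) (g x)%:E)%E); last first.
  by apply: ge0_subset_integral => // x _; rewrite lee_fin.
rewrite ge0_integral_bigsetU//; last 4 first.
- exact: iota_uniq.
- exact: trivIset_dyadic_cube.
- exact: measurable_funTS.
- by move=> x _; rewrite lee_fin.
rewrite big_seq.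
apply: (@le_trans _ _ (\sum_(k <- iota 0 N | k \in iota 0 N) c%:E)%E).
  rewrite -big_seq sumEFin big_const_seq count_predT size_iota.
  by rewrite iter_addr_0 mulr_natl.
by apply: lee_sum => k; rewrite mem_iota => /andP[_ kN]; exact: cg.
Qed.

Lemma integral_pnormX_ge (N : nat) :
  ((N%:R * cube_mass)%:E <= \int[lebesgue3 R]_x
    (pnorm (3 / 2) (hedgehog (profile (2^-1 ^+ N)) x) `^ (3 / 2))%:E)%E.
Proof.
have eta0 : 0 < 2^-1 ^+ N :> R by rewrite exprn_gt0.
have p0 : 3 / 2 != 0 :> R by lra.
apply: integral_dyadic_cubes_ge.
- exact: measurable_pnormX_hedgehog p0 (elementary_profile eta0).
- by move=> x; exact: powR_ge0.
- exact: integral_dyadic_cube_ge.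
Qed.

Lemma divergence_profileE eta x : 0 < eta ->
  pnorm 1 (sigma_p (hedgehog (profile eta)) x) =
  `|3 * profile eta (normsq3 x) + 2 * normsq3 x * dprofile eta (normsq3 x)|.
Proof.
by move=> eta0; exact: pnorm1_sigma_p_hedgehog (is_derive_profile _ eta0).
Qed.

(** Each of the two kernels integrates to [pi^3], whence [128 = 64 * 2] and no dependence on
    [eta]. *)
Lemma integral_sigma_p_le eta : 0 < eta ->
  (\int[lebesgue3 R]_x (pnorm 1 (sigma_p (hedgehog (profile eta)) x))%:E <=
   (128 * pi ^+ 3)%:E)%E.
Proof.
move=> eta0.
pose g x := `|3 * profile eta (normsq3 x) +
              2 * normsq3 x * dprofile eta (normsq3 x)|.
have mg : measurable_fun setT g.
  apply: measurableT_comp; first exact: normr_measurable.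
  apply: elementary_measurable; apply: elementary_add; apply: elementary_mul.
  - exact: elementary_cst.
  - exact: elementary_profile.
  - by apply: elementary_mul; [exact: elementary_cst|exact: elementary_normsq3].
  - exact: elementary_dprofile.
have mk (e : R) : 0 < e ->
    measurable_fun setT (fun x : R * R * R => (poisson3 e x)%:E).
  move=> e0; apply/measurable_EFinP.
  have mk : measurable_fun setT (poisson e).
    by apply: continuous_measurable_fun; exact: continuous_poisson.
  apply: measurable_funM; first apply: measurable_funM.
  - exact: measurableT_comp mk (measurableT_comp measurable_fst measurable_fst).
  - exact: measurableT_comp mk (measurableT_comp measurable_snd measurable_fst).
  - exact: measurableT_comp mk measurable_snd.
have k0 (e : R) x : 0 < e -> (0 <= (poisson3 e x)%:E)%E.
  move=> e0; rewrite lee_fin; apply: mulr_ge0; first apply: mulr_ge0;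
    exact: poisson_ge0.
under eq_integral do rewrite divergence_profileE//.
apply: (@le_trans _ _ (\int[lebesgue3 R]_x
    (64%:E * ((poisson3 1 x)%:E + (poisson3 eta x)%:E)))%E).
  apply: ge0_le_integral => //.
  - exact/measurable_EFinP.
  - by apply: measurable_funeM; apply: emeasurable_funD; exact: mk.
  - by move=> x _; rewrite -EFinD -EFinM lee_fin; exact: divergence_profile_le.
rewrite ge0_integralZl//; last 2 first.
- by apply: emeasurable_funD; exact: mk.
- by move=> x _; rewrite adde_ge0// k0.
rewrite ge0_integralD//; last 4 first.
- by move=> x _; exact: k0.
- exact: mk.
- by move=> x _; exact: k0.
- exact: mk.
rewrite !integral_poisson3// -EFinD -EFinM lee_fin; lra.
Qed.

End LowerBound.

(** * The contradiction, as the number of dyadic scales grows *)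

Theorem mainTheorem3 (R : realType) :
  ~ exists C : R, 0 < C /\
    forall f : space3 R -> spinor R, C0_infty f ->
      ((\int[lebesgue3 R]_x (pnorm (3 / 2) (f x) `^ (3 / 2))%:E) `^ (2 / 3) <=
       C%:E * \int[lebesgue3 R]_x (pnorm 1 (sigma_p f x))%:E)%E.
Proof.
move=> [C [C0 H]].
(* The assumed inequality, raised to the power 3/2, would bound [N * cube_mass] by this constant for
   every [N]. *)
pose M : R := (C * (128 * pi ^+ 3)) `^ (3 / 2).
have [N hN] : exists N : nat, M < N%:R * (cube_mass : R).
  exists (Num.bound (M / cube_mass)).
  rewrite -ltr_pdivrMr ?cube_mass_gt0//.
  by apply: archi_boundP; rewrite divr_ge0 ?powR_ge0// ltW// cube_mass_gt0.
have eta0 : 0 < 2^-1 ^+ N :> R by rewrite exprn_gt0.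
have C0f : C0_infty (hedgehog (profile (2^-1 ^+ N : R))).
  apply: C0_infty_hedgehog; first exact: elementary_profile.
  by move=> s; exact: profile_eq0.
have CM0 : 0 <= C * (128 * pi ^+ 3) :> R.
  by rewrite !mulr_ge0 ?exprn_ge0 ?pi_ge0// ltW.
have Nc0 : 0 <= N%:R * cube_mass :> R by rewrite mulr_ge0// ltW// cube_mass_gt0.
have lower := @integral_pnormX_ge R N.
have upper := integral_sigma_p_le eta0.
have HN := H _ C0f; move: HN lower upper.
set I := integral _ _ _; set J := integral _ _ _ => HN lower upper.
have h : (N%:R * cube_mass) `^ (2 / 3) <= C * (128 * pi ^+ 3).
  rewrite -lee_fin -poweR_EFin; apply: le_trans (le_trans _ HN) _.
    (* Monotonicity of the power is taken on [[0, +oo]], so the finiteness of [I] need not be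
       established. *)
    apply: gt0_ler_poweR lower; rewrite ?in_itv/= ?leey ?andbT ?lee_fin//.
    by apply: integral_ge0 => x _; rewrite lee_fin powR_ge0.
  by rewrite EFinM lee_pmul2l ?lte_fin.
have : (N%:R * cube_mass) `^ (2 / 3) `^ (3 / 2) <= M.
  by apply: ge0_ler_powR; rewrite ?nnegrE ?powR_ge0.
rewrite -powRrM (_ : 2 / 3 * (3 / 2) = 1); last by field.
by rewrite powRr1// leNgt hN.
Qed.
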